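(* There exist a compact metric space $(X,d_X)$ and a homeomorphism $T:X\to X$ such that $(X,T)$ is (topologically) transitive, completely Li--Yorke chaotic, and has positive topological entropy $h_{\rm top}(X,T)>0$.
   Context: A topological dynamical system (t.d.s.) is a pair $(X,T)$ where $X$ is a compact metric space with metric $d_X$ and $T:X\to X$ is a homeomorphism. A proper pair is $(x,y)\in X\times X$ with $x\ne y$. A pair $(x,y)$ is a positively scrambled (Li--Yorke) pair for $T$ if $\liminf_{n\to+\infty}d_X(T^nx,T^ny)=0$ and $\limsup_{n\to+\infty}d_X(T^nx,T^ny)>0$; it is a negatively scrambled pair for $T$ if it is a positively scrambled pair for $T^{-1}$. $(X,T)$ is completely Li--Yorke chaotic (completely scrambled) if each proper pair is either a positively or a negatively scrambled pair for $T$ (inclusive or). Topological entropy: $h_{\rm top}(X,T)=\lim_{\epsilon\to0}\limsup_{n\to\infty}\frac1n\log s_n(X,T,\epsilon)$, where $s_n(X,T,\epsilon)$ is the maximal cardinality of a set $E\subset X$ such that for any distinct $x,y\in E$ there is $0\le n'<n$ with $d_X(T^{n'}x,T^{n'}y)>\epsilon$. *)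

(* Defs.v *)
From HB Require Import structures.
From mathcomp Require Import all_boot all_order all_algebra finmap.
From mathcomp Require Import all_classical all_reals all_analysis.

Set Implicit Arguments.
Unset Strict Implicit.
Unset Printing Implicit Defensive.

Import Order.TTheory GRing.Theory Num.Theory.
Import numFieldTopology.Exports.

Local Open Scope classical_set_scope.
Local Open Scope ring_scope.

Definition homeomorphism (X : topologicalType) (T Tinv : X -> X) : Prop :=
  [/\ cancel T Tinv, cancel Tinv T, continuous T & continuous Tinv].

Definition topologically_transitive (X : topologicalType) (T : X -> X) : Prop :=
  forall U V : set X, open U -> open V -> U !=set0 -> V !=set0 ->
    exists n : nat, U `&` (iter n T @^-1` V) !=set0.

(* The distances are injected in the extended reals, where liminf and limsup
   are defined for every sequence. *)
Definition orbit_dist (R : realType) (X : metricType R) (T : X -> X)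
    (x y : X) (n : nat) : \bar R :=
  (mdist (iter n T x) (iter n T y))%:E.

Definition positively_scrambled (R : realType) (X : metricType R)
    (T : X -> X) (x y : X) : Prop :=
  limn_einf (orbit_dist T x y) = 0%E /\ (0 < limn_esup (orbit_dist T x y))%E.

Definition completely_scrambled (R : realType) (X : metricType R)
    (T Tinv : X -> X) : Prop :=
  forall x y : X, x <> y ->
    positively_scrambled T x y \/ positively_scrambled Tinv x y.

Definition orbit_separated (R : realType) (X : metricType R) (T : X -> X)
    (n : nat) (e : R) (E : {fset X}) : Prop :=
  forall x y : X, x \in E -> y \in E -> x <> y ->
    exists2 k : nat, (k < n)%N & e < mdist (iter k T x) (iter k T y).

(* Defined as an extended real supremum, which is the maximal cardinality
   whenever the cardinalities are bounded; they are when X is compact, T is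
   continuous and 0 < e. *)
Definition sep_card (R : realType) (X : metricType R) (T : X -> X)
    (n : nat) (e : R) : \bar R :=
  ereal_sup [set (#|` E|%:R)%:E | E in orbit_separated T n e].

(* The term at n = 0 is a junk value, irrelevant to the limsup. The limit
   exists in \bar R because the limsup is nonincreasing in e. *)
Definition topological_entropy (R : realType) (X : metricType R)
    (T : X -> X) : \bar R :=
  lim (limn_esup (fun n : nat => (n%:R^-1)%:E * lne (sep_card T n e))%E
         @[e --> (0 : R)^'+]).

(* Main.v *)
(**
  Write positions in mixed radix, with [radix i = 2 ^ (i + 3)] values for the
  i-th digit, and consider sequences over the alphabet [{None, Some false, Some
  true}] in which a position carries a bit exactly when none of its digits
  vanishes, subject to one family of parity checks: the bits at positions that
  differ only in the i-th digit have sum 0.  Let X consist of the bi-infinite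
  sequences all of whose windows occur in such a configuration, with the shift.

  The digit 0 creates windows of [None] of every length with bounded gaps, so
  every pair of points is proximal both forwards and backwards.  Two points
  that differ only at finitely many positions have the same digit structure,
  because the pattern of [None]s far away determines it, and then the parity
  check of a level i whose period exceeds the diameter of the set of
  differences involves only one of them and forces the points to be equal.
  Hence distinct points differ infinitely often in one of the two directions,
  where they form a scrambled pair.  The checks only use a fraction
  [1 / radix i] of the bits at level i; these fractions are summable, so the
  entropy is positive.
*)
From HB Require Import structures.
Require Import Defs.
From mathcomp Require Import all_boot all_order all_algebra.
From mathcomp Require Import all_classical all_reals all_analysis.
From mathcomp Require Import finmap zify.

Set Implicit Arguments.
Unset Strict Implicit.
Unset Printing Implicit Defensive.

Import Order.TTheory GRing.Theory Num.Theory.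
Import numFieldTopology.Exports.

(** * Mixed-radix digits *)

Definition radix (i : nat) : nat := 2 ^ i.+3.

Fixpoint period (n : nat) : nat := if n is m.+1 then radix m * period m else 1.

Arguments period : simpl never.

Lemma periodS n : period n.+1 = radix n * period n. Proof. by []. Qed.

Definition digit (i u : nat) : nat := (u %/ period i) %% radix i.

Definition set_digit (i s u : nat) : nat :=
  u %/ period i.+1 * period i.+1 + s * period i + u %% period i.

Lemma radix_ge8 i : 8 <= radix i.
Proof. by rewrite /radix !expnS; have := expn_gt0 2 i; lia. Qed.

Lemma period_gt0 n : 0 < period n.
Proof. by elim: n => // n IH; rewrite periodS muln_gt0 IH andbT (leq_trans _ (radix_ge8 n)). Qed.

Lemma ltn_period n : n < period n.
Proof.
elim: n => // n IH; rewrite periodS; have := radix_ge8 n; nia.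
Qed.

Lemma dvdn_period i j : i <= j -> period i %| period j.
Proof.
elim: j => [|j IH]; first by rewrite leqn0 => /eqP ->.
rewrite leq_eqVlt => /orP[/eqP -> //|ij]; rewrite periodS dvdn_mull //; exact: IH.
Qed.

Lemma leq_period i j : i <= j -> period i <= period j.
Proof. by move=> ij; apply: dvdn_leq; [exact: period_gt0|exact: dvdn_period]. Qed.

Lemma ltn_digit i u : digit i u < radix i.
Proof. by rewrite ltn_mod (leq_trans _ (radix_ge8 i)). Qed.

Lemma digit_split i u :
  u = u %/ period i.+1 * period i.+1 + digit i u * period i + u %% period i.
Proof.
rewrite {1}(divn_eq u (period i)) {1}(divn_eq (u %/ period i) (radix i)).
rewrite -divnMA periodS [period i * radix i]mulnC.
by rewrite mulnDl mulnA.
Qed.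

Lemma set_digit_id i u : set_digit i (digit i u) u = u.
Proof. by rewrite /set_digit -digit_split. Qed.

Lemma divn_period_digit i h s r : s < radix i -> r < period i ->
  (h * period i.+1 + s * period i + r) %/ period i.+1 = h.
Proof.
move=> sq rl; rewrite -addnA divnMDl ?period_gt0 // divn_small ?addn0 // periodS; nia.
Qed.

Lemma modn_period_digit i h s r : r < period i ->
  (h * period i.+1 + s * period i + r) %% period i = r.
Proof. by move=> rl; rewrite periodS mulnA -mulnDl modnMDl modn_small. Qed.

Lemma set_digit_digits i h s s' r : s < radix i -> r < period i ->
  set_digit i s' (h * period i.+1 + s * period i + r) =
  h * period i.+1 + s' * period i + r.
Proof. by move=> sq rl; rewrite /set_digit divn_period_digit // modn_period_digit. Qed.

Lemma digit_digits i h s r : s < radix i -> r < period i ->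
  digit i (h * period i.+1 + s * period i + r) = s.
Proof.
move=> sq rl; rewrite /digit periodS mulnA -mulnDl divnMDl ?period_gt0 // divn_small // addn0.
by rewrite modnMDl modn_small.
Qed.

Lemma set_digit_twice i s s' u : s < radix i ->
  set_digit i s' (set_digit i s u) = set_digit i s' u.
Proof.
by move=> sq; rewrite [set_digit i s u]/set_digit set_digit_digits // ltn_pmod // period_gt0.
Qed.

Lemma digit_set_digit i s u : s < radix i -> digit i (set_digit i s u) = s.
Proof. by move=> sq; rewrite digit_digits // ltn_pmod // period_gt0. Qed.

Lemma digit_periodic j n c r : j < n -> digit j (c * period n + r) = digit j r.
Proof.
move=> jn; rewrite /digit; case/dvdnP: (dvdn_period jn) => k ->.
by rewrite periodS [k * _]mulnA [c * _]mulnA divnMDl ?period_gt0 // mulnA modnMDl.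
Qed.

Lemma digit_modn j n u : j < n -> digit j (u %% period n) = digit j u.
Proof. by move=> jn; rewrite [in RHS](divn_eq u (period n)) digit_periodic. Qed.

Lemma digit_high i j u v : i < j ->
  u %/ period i.+1 = v %/ period i.+1 -> digit j u = digit j v.
Proof.
move=> ij e; rewrite /digit; case/dvdnP: (dvdn_period ij) => k ->.
by rewrite mulnC (divnMA u) (divnMA v) e.
Qed.

Lemma set_digit_div i s u : s < radix i ->
  set_digit i s u %/ period i.+1 = u %/ period i.+1.
Proof. by move=> sq; rewrite divn_period_digit // ltn_pmod // period_gt0. Qed.

Lemma set_digit_mod i s u : set_digit i s u %% period i = u %% period i.
Proof. by rewrite modn_period_digit // ltn_pmod // period_gt0. Qed.

Lemma digit_set_digit_neq i j s u : s < radix i -> j != i ->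
  digit j (set_digit i s u) = digit j u.
Proof.
move=> sq; rewrite neq_ltn => /orP[ji|ij].
  by rewrite -(digit_modn _ ji) set_digit_mod digit_modn.
by apply: (digit_high ij); rewrite set_digit_div.
Qed.

Lemma divn_set_digit i n s u : i < n -> s < radix i ->
  set_digit i s u %/ period n = u %/ period n.
Proof.
move=> lt_in sq; case/dvdnP: (dvdn_period lt_in) => k ->.
by rewrite mulnC (divnMA (set_digit i s u)) (divnMA u) set_digit_div.
Qed.

Lemma set_digit_periodic i n s c u : i < n ->
  set_digit i s (c * period n + u) = c * period n + set_digit i s u.
Proof.
move=> lt_in; case/dvdnP: (dvdn_period lt_in) => k ->; rewrite /set_digit.
rewrite [c * _]mulnA divnMDl ?period_gt0 // mulnDl -!addnA; do 3 congr (_ + _).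
by rewrite periodS mulnA modnMDl.
Qed.

(** For [i < j], changing digit [i] only acts on the remainder modulo [period j], while changing
    digit [j] keeps that remainder and rewrites the quotient. *)
Lemma set_digitC i j s s' u : s < radix i -> s' < radix j -> i != j ->
  set_digit i s (set_digit j s' u) = set_digit j s' (set_digit i s u).
Proof.
wlog ij : i j s s' / i < j.
  move=> W si sj; rewrite neq_ltn => /orP[] ?; last apply/esym; apply: W => //; lia.
move=> si sj _.
have lij : period i.+1 %| period j by exact: dvdn_period.
case/dvdnP: (lij) => k lk.
have E t : set_digit j s' t = (t %/ period j.+1 * radix j + s') * period j + t %% period j.
  by rewrite /set_digit periodS mulnA mulnDl.
have Emod t : set_digit i s t %% period j = set_digit i s (t %% period j).
  rewrite {1}(divn_eq t (period j)) set_digit_periodic // modnMDl modn_small //.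
  rewrite -[X in _ < X]mul1n -ltn_divLR ?period_gt0 // divn_set_digit // divn_small //.
  by rewrite ltn_pmod // period_gt0.
by rewrite !E set_digit_periodic // Emod divn_set_digit // ltnW.
Qed.

(** * Parity checks and blocks *)

(* The bits at positions having a digit [radix i - 1] are the checksums: they are
   determined by the free bits [f]. *)
Fixpoint bits (n : nat) (f : nat -> bool) (u : nat) : bool :=
  if n is m.+1 then
    if digit m u == (radix m).-1 then
      \big[addb/false]_(1 <= s < (radix m).-1) bits m f (set_digit m s u)
    else bits m f u
  else f u.

Arguments bits : simpl never.

Lemma bitsS n f u : bits n.+1 f u = if digit n u == (radix n).-1 then
      \big[addb/false]_(1 <= s < (radix n).-1) bits n f (set_digit n s u) else bits n f u.
Proof. by []. Qed.

(** At the newest level the checksum is defined to cancel the other terms. At a lower level a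
    checksum is a sum of bits that already pass the check, as exchanging the two sums shows. *)
Lemma bits_parity n f i u : i < n ->
  \big[addb/false]_(1 <= s < radix i) bits n f (set_digit i s u) = false.
Proof.
elim: n u => // n IH u; rewrite ltnS leq_eqVlt => /orP[/eqP -> {i IH}|lt_in].
  have q8 := radix_ge8 n.
  rewrite [X in index_iota 1 X](_ : radix n = (radix n).-1.+1); last by lia.
  rewrite big_nat_recr; last by lia.
  rewrite /= [X in addb X _](eq_big_nat _ _ (F2 := fun s => bits n f (set_digit n s u))).
    rewrite bitsS digit_set_digit ?eqxx; last by lia.
    rewrite [X in addb _ X](eq_big_nat _ _ (F2 := fun s => bits n f (set_digit n s u))).
      exact: addbb.
    by move=> s sq; rewrite set_digit_twice //; lia.
  move=> s sq; rewrite bitsS digit_set_digit; last by lia.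
  by rewrite ltn_eqF //; lia.
have [e|e] := boolP (digit n u == (radix n).-1); last first.
  rewrite (eq_big_nat _ _ (F2 := fun s => bits n f (set_digit i s u))) ?IH // => s sq.
  rewrite bitsS digit_set_digit_neq ?(negbTE e) //; lia.
rewrite (eq_big_nat _ _ (F2 := fun s => \big[addb/false]_(1 <= t < (radix n).-1)
  bits n f (set_digit i s (set_digit n t u)))); last first.
  move=> s sq; rewrite bitsS digit_set_digit_neq ?e; [|lia..].
  by apply: eq_big_nat => t tq; rewrite set_digitC //; lia.
by rewrite exchange_big_nat /= big1_seq // => t _; exact: IH.
Qed.

(** Changing digits below [n] never leaves the interval [[0, period n)], so checksums there only
    read free bits from it. *)
Lemma bits_ext n f g u : u < period n -> (forall v, v < period n -> f v = g v) ->
  bits n f u = bits n g u.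
Proof.
move=> ul fg.
suff E m : m <= n -> forall v, v < period n -> bits m f v = bits m g v by exact: E.
elim: m => [_ v|m IH mn v vl]; first exact: fg.
rewrite !bitsS; case: ifP => _; last by apply: IH; [exact: ltnW|].
apply: eq_big_nat => s sq; apply: IH; first exact: ltnW.
have sq' : s < radix m by lia.
have := divn_set_digit v mn sq'; rewrite (divn_small vl) => e.
by rewrite -[period n]mul1n -ltn_divLR ?period_gt0 // e.
Qed.

Lemma bits_shift n m f c u : m <= n ->
  bits m f (c * period n + u) = bits m (fun v => f (c * period n + v)) u.
Proof.
elim: m u => // m IH u mn.
rewrite !bitsS digit_periodic // IH; last exact: ltnW.
case: ifP => _ //; apply: eq_big_nat => s sq; rewrite set_digit_periodic // IH //; exact: ltnW.
Qed.

Lemma bits_free n f u : (forall i, i < n -> digit i u < (radix i).-1) -> bits n f u = f u.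
Proof.
elim: n => // n IH D; rewrite bitsS ifF; first by apply: IH => i /ltnW /D.
by rewrite ltn_eqF // D.
Qed.

Definition active (n u : nat) : bool := all (fun i => digit i u != 0) (iota 0 n).

Lemma activeP n u : reflect (forall i, i < n -> digit i u != 0) (active n u).
Proof.
apply: (iffP allP) => H i; last by rewrite mem_iota add0n => /H.
by move=> lt_in; apply: H; rewrite mem_iota.
Qed.

Definition block (n : nat) (f : nat -> bool) (u : nat) : option bool :=
  if active n u then Some (bits n f u) else None.

(** A slot that is neither the padding slot 0 nor the checksum slot holds an arbitrary block of the
    previous level. Thus blocks embed in larger ones and several slots can be filled
    independently. *)
Lemma block_slot n f s u : 0 < s -> s < (radix n).-1 -> u < period n ->
  block n.+1 f (s * period n + u) = block n (fun v => f (s * period n + v)) u.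
Proof.
move=> s0 sq ul; have q8 := radix_ge8 n.
have ds : digit n (s * period n + u) = s.
  have := @digit_digits n 0 s u; rewrite mul0n add0n; apply => //; lia.
rewrite /block bitsS ds (ltn_eqF sq) bits_shift //.
have -> // : active n.+1 (s * period n + u) = active n u.
apply/activeP/activeP => H i lt_in; first by rewrite -(@digit_periodic i n s) // H // ltnW.
move: lt_in; rewrite ltnS leq_eqVlt => /orP[/eqP ->|lt_in].
  by rewrite ds -lt0n.
by rewrite digit_periodic // H.
Qed.

Lemma block_ext n f g u : u < period n -> (forall v, v < period n -> f v = g v) ->
  block n f u = block n g u.
Proof. by move=> ul fg; rewrite /block (bits_ext ul fg). Qed.

(** * Rigidity of blocks *)

Lemma active_set_digit n i s u : 0 < s -> s < radix i ->
  active n u -> active n (set_digit i s u).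
Proof.
move=> s0 sq /activeP au; apply/activeP => j jn.
by have [->|ji] := eqVneq j i; [rewrite digit_set_digit // -lt0n|rewrite digit_set_digit_neq // au].
Qed.

Lemma set_digit_far i s u : s != digit i u ->
  (u + period i <= set_digit i s u) || (set_digit i s u + period i <= u).
Proof.
have := digit_split i u; rewrite /set_digit; set h := digit i u => e.
rewrite neq_ltn => /orP[] sh.
  have : s.+1 * period i <= h * period i by rewrite leq_mul2r sh orbT.
  by rewrite mulSn => ?; apply/orP; right; lia.
have : h.+1 * period i <= s * period i by rewrite leq_mul2r sh orbT.
by rewrite mulSn => ?; apply/orP; left; lia.
Qed.

Lemma near_slot n u v : u %/ period n = v %/ period n -> u < v + period n.
Proof.
move=> e; rewrite (divn_eq u (period n)) (divn_eq v (period n)) e.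
have := ltn_pmod u (period_gt0 n); lia.
Qed.

(** Equal displacements from positions congruent modulo [period i] produce the same carries into
    digit [i], so they change this digit by the same amount modulo [radix i]. Sums replace
    differences to avoid truncated subtraction. *)
Lemma digit_diff i u v u' v' : u' + v = u + v' -> u = v %[mod period i] ->
  digit i u' + digit i v = digit i u + digit i v' %[mod radix i].
Proof.
move=> e uv; rewrite /digit !modnDm; congr (_ %% _).
have uv' : u' = v' %[mod period i].
  by apply/eqP; rewrite -(eqn_modDr v) e [v' + v]addnC eqn_modDr; exact/eqP.
have l0 := period_gt0 i.
apply/eqP; rewrite -(eqn_pmul2r l0) !mulnDl; apply/eqP.
have := divn_eq u (period i); have := divn_eq v (period i).
have := divn_eq u' (period i); have := divn_eq v' (period i); rewrite uv uv'; lia.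
Qed.

Lemma xor_unique (F G : nat -> bool) a b s0 : a <= s0 < b ->
  \big[addb/false]_(a <= s < b) F s = \big[addb/false]_(a <= s < b) G s ->
  (forall s, a <= s < b -> s != s0 -> F s = G s) -> F s0 = G s0.
Proof.
move=> s0r; have s0i : s0 \in index_iota a b by rewrite mem_index_iota.
rewrite !(bigD1_seq s0) ?iota_uniq //= => + FG.
have -> : \big[addb/false]_(a <= s < b | s != s0) F s =
          \big[addb/false]_(a <= s < b | s != s0) G s.
  by rewrite big_seq_cond [RHS]big_seq_cond; apply: eq_bigr => s /andP[]; rewrite mem_index_iota => /FG.
by move/addIb.
Qed.

Lemma period_lt_inv m n : period m < period n -> m < n.
Proof. by move=> h; rewrite ltnNge; apply/negP => /leq_period; rewrite leqNgt h. Qed.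

Section Rigidity.
Variables (n m : nat) (f g : nat -> bool) (a b c D L J : nat).
Hypotheses (an : a + L <= period n) (bm : b + L <= period m) (DJ : D <= period J).
Hypotheses (cJ : period J.+2 <= c) (LJ : c + D + period J.+2 <= L).
Hypothesis agr : forall j, j < L -> ~~ (c <= j < c + D) ->
  block n f (a + j) = block m g (b + j).

Let Jn : J.+2 < n. Proof. by apply: period_lt_inv; have := period_gt0 J.+2; lia. Qed.
Let Jm : J.+2 < m. Proof. by apply: period_lt_inv; have := period_gt0 J.+2; lia. Qed.

(** The margins of length [period J.+2] around the exceptional interval keep in the window every
    position that shares with [u] the digits from [J.+2] on. *)
Lemma agree_near u v u' v' j : c <= j < c + D -> u = a + j -> v = b + j ->
  u' %/ period J.+2 = u %/ period J.+2 -> u' + v = u + v' ->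
  ~~ (a + c <= u' < a + c + D) -> block n f u' = block m g v'.
Proof.
move=> jc -> -> e e' out.
have h1 := near_slot e; have h2 := near_slot (esym e).
have -> : v' = b + (u' - a) by lia.
by rewrite -agr; [congr block; lia|lia|lia].
Qed.

(** The pattern of [None]s, read outside the exceptional interval, determines the digits up to [J];
    they are compared one by one from the lowest. *)
Lemma phase_eq u v j : c <= j < c + D -> u = a + j -> v = b + j -> active n u ->
  u = v %[mod period J.+1].
Proof.
move=> jc ua vb au.
suff E i : i <= J.+1 -> u = v %[mod period i] by exact: E.
elim: i => [_|i IH iJ]; first by rewrite !modn1.
have uvi := IH (ltnW iJ).
(* Otherwise some position has a nonzero i-th digit for the phase [u] and a zero
   one for [v]; changing the digit [J.+1] moves it out of the exceptional set. *)
have [e|ne] := eqVneq (digit i u) (digit i v).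
  have M w : w %% period i.+1 = digit i w * period i + w %% period i.
    have := digit_split i w; rewrite {1}(divn_eq w (period i.+1)); lia.
  by rewrite !M e uvi.
exfalso.
have lv : period J.+2 <= v by lia.
have im : i < m by lia.
have DJ1 : D <= period J.+1 by rewrite (leq_trans DJ) // leq_period.
have q8 := radix_ge8 i; have du := ltn_digit i u; have dv := ltn_digit i v.
(* [s] is the difference of the two digits modulo [radix i]. A position near [u] with i-th digit [s]
   is matched with one near [v] whose i-th digit is 0. *)
pose s := if digit i v <= digit i u then digit i u - digit i v
  else digit i u + radix i - digit i v.
have sq : 0 < s < radix i by rewrite /s; case: (leqP (digit i v)); lia.
have key w : active n w -> digit i w = s -> w %/ period J.+2 = u %/ period J.+2 ->
    ~~ (a + c <= w < a + c + D) -> False.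
  move=> aw dw wu out.
  have wuv : u <= w + v.
    by rewrite (leq_trans (ltnW (near_slot (esym wu)))) // leq_add2l.
  have e : w + v = u + (w + v - u) by rewrite subnKC.
  have := agree_near jc ua vb wu e out.
  rewrite {1}/block aw /block; case: ifP => // /activeP /(_ i _) di _.
  have := di im.
  have := digit_diff e uvi; rewrite dw.
  have dq := ltn_digit i (w + v - u).
  have -> : s + digit i v = digit i u %[mod radix i].
    rewrite /s; case: (leqP (digit i v)) => h; first by rewrite subnK.
    by rewrite subnK ?modnDr // (leq_trans (ltnW dv)) // leq_addl.
  rewrite -{1}[digit i u]addn0 => /eqP; rewrite eqn_modDl mod0n modn_small //.
  by move=> /eqP <-.
case/andP: sq => s0 sq.
have au' := active_set_digit s0 sq au.
have du' := digit_set_digit u sq.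
have eu' : set_digit i s u %/ period J.+2 = u %/ period J.+2 by apply: divn_set_digit => //; exact: ltnW.
have [|out] := boolP (a + c <= set_digit i s u < a + c + D); last exact: (key (set_digit i s u)).
set u' := set_digit i s u.
move=> inn.
have q8' := radix_ge8 J.+1.
(* A nonzero digit other than the current one: the position stays active and moves by at least
   [period J.+1 >= D]. *)
pose t := if digit J.+1 u' == 1 then 2 else 1.
have tq : 0 < t < radix J.+1 by rewrite /t; case: ifP; lia.
case/andP: tq => t0 tq.
have td : t != digit J.+1 u' by rewrite /t; case: (eqVneq _ 1) => [->|]; rewrite // eq_sym.
apply: (key (set_digit J.+1 t u')).
- exact: active_set_digit.
- rewrite digit_set_digit_neq // ?neq_ltn ?iJ //.
- by rewrite divn_set_digit.
- by move: inn (set_digit_far td); clear -DJ1; lia.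
Qed.

(** In the check of level [J] through [u], all other positions are at least [period J >= D] away
    from [u], hence outside the exceptional interval. The phases agree, so the check through [v] has
    the same other terms and forces the same bit. *)
Lemma rigid_left j : j < L -> active n (a + j) -> block n f (a + j) = block m g (b + j).
Proof.
move=> jL; have [jc|] := boolP (c <= j < c + D); last by move=> ? _; exact: agr.
set u := a + j; set v := b + j => au.
have uv : u = v %[mod period J.+1] by exact: (@phase_eq _ _ j).
have uv' : u = v %[mod period J].
  by rewrite -(modn_dvdm u (dvdn_period (leqnSn J))) uv modn_dvdm // dvdn_period.
have q8 := radix_ge8 J.
have shift s : set_digit J s u + v = u + set_digit J s v.
  rewrite {2}(divn_eq u (period J.+1)) {1}(divn_eq v (period J.+1)) uv /set_digit uv'; lia.
have duv : digit J u = digit J v.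
  by rewrite -(@digit_modn J J.+1) // uv digit_modn.
have near s : s < radix J -> s != digit J u ->
    block n f (set_digit J s u) = block m g (set_digit J s v).
  move=> sq sd; apply: (@agree_near u v _ _ j) => //; first exact: divn_set_digit.
  have := set_digit_far sd; lia.
have du0 : digit J u != 0 by apply: (activeP _ _ au); lia.
have dq := ltn_digit J u.
have bits_near s : 1 <= s < radix J -> s != digit J u ->
    active m (set_digit J s v) /\ bits n f (set_digit J s u) = bits m g (set_digit J s v).
  case/andP=> s0 sq sd; have := near s sq sd.
  rewrite /block active_set_digit //; case: ifP => // _; by case.
(* Some other position of the check is active on both sides; putting back the nonzero digit
   [digit J u = digit J v] gives [v]. *)
have av : active m v.
  pose t := if digit J u == 1 then 2 else 1.
  have tq : 1 <= t < radix J by rewrite /t; case: ifP; lia.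
  have td : t != digit J u by rewrite /t; case: (eqVneq _ 1) => [->|]; rewrite // eq_sym.
  have [av _] := bits_near t tq td.
  rewrite -(set_digit_id J v) -duv -(@set_digit_twice J t); last by lia.
  by apply: active_set_digit => //; lia.
rewrite /block au av; congr Some.
rewrite -[u in bits n f u](set_digit_id J) -[v in bits m g v](set_digit_id J) -duv.
apply: (xor_unique (F := fun s => bits n f (set_digit J s u))
  (G := fun s => bits m g (set_digit J s v))
  (a := 1) (b := radix J)); first by lia.
  by rewrite !bits_parity //; lia.
by move=> s sr sd; have [] := bits_near s sr sd.
Qed.

End Rigidity.

(** [rigid_left] needs an active position on one side; it is applied in both directions, and two
    inactive positions both carry [None]. *)
Lemma rigid_window n m f g a b c D L J :
  a + L <= period n -> b + L <= period m -> D <= period J ->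
  period J.+2 <= c -> c + D + period J.+2 <= L ->
  (forall j, j < L -> ~~ (c <= j < c + D) -> block n f (a + j) = block m g (b + j)) ->
  forall j, j < L -> block n f (a + j) = block m g (b + j).
Proof.
move=> an bm DJ cJ LJ agr j jL.
have [au|nu] := boolP (active n (a + j)); first exact: (rigid_left an bm DJ cJ LJ agr).
have [av|nv] := boolP (active m (b + j)); last by rewrite /block (negbTE nu) (negbTE nv).
apply/esym; apply: (rigid_left bm an DJ cJ LJ) => // i iL ic.
by apply/esym; exact: agr.
Qed.

Lemma block_None n f u i : i < n -> u %% period i.+1 < period i -> block n f u = None.
Proof.
move=> lt_in ui; rewrite /block ifF //; apply/negP => /activeP /(_ _ lt_in).
by rewrite -(@digit_modn i i.+1) // /digit divn_small // mod0n.
Qed.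

Lemma block_pad n f u i : i < n -> period i.+1 %| u ->
  forall k, k < period i -> block n f (u + k) = None.
Proof.
move=> lt_in /dvdnP[c ->] k kl; apply: (@block_None _ _ _ i) => //.
by rewrite modnMDl (leq_ltn_trans (leq_mod _ _)).
Qed.

Local Open Scope classical_set_scope.
Local Open Scope ring_scope.

(** * Admissible sequences *)

Definition occurs (x : int -> option bool) (s : int) (L : nat) : Prop :=
  exists n f a, (a + L <= period n)%N /\
    forall j : nat, (j < L)%N -> x (s + j%:Z) = block n f (a + j).

(** The block may vary with the window, so the condition passes to pointwise limits. *)
Definition admissible (x : int -> option bool) : Prop :=
  forall s L, occurs x s L.

Lemma admissible_shift x t : admissible x -> admissible (fun k => x (k + t)).
Proof.
move=> ax s L; have [n [f [a [an xa]]]] := ax (s + t) L.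
by exists n, f, a; split=> // j jL; rewrite addrAC xa.
Qed.

Lemma none_window x n s : admissible x ->
  exists2 j : nat, (j <= period n.+1)%N &
    forall k : nat, (k < period n)%N -> x (s + (j + k)%:Z) = None.
Proof.
move=> ax; have [m [f [a [am xa]]]] := ax s (period n.+1 + period n)%N.
have nm : (n < m)%N.
  by apply: ltnW; apply: period_lt_inv; have := period_gt0 n; lia.
have rl := ltn_pmod a (period_gt0 n.+1).
(* The distance to the next multiple of [period n.+1], where a run with n-th digit 0 begins. *)
exists (period n.+1 - a %% period n.+1)%N; first exact: leq_subr.
move=> k kl; rewrite xa; last by rewrite -addnS leq_add // leq_subr.
rewrite addnA; apply: (@block_pad _ _ _ n) => //.
rewrite {1}(divn_eq a (period n.+1)) -addnA subnKC; last exact: ltnW.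
by rewrite dvdn_add // dvdn_mull.
Qed.

(** A run of [None]s in [x] of length [period M.+2] is long enough to contain a whole run of length
    [period M] in [y], wherever the latter falls. *)
Lemma both_none x y M : admissible x -> admissible y ->
  exists C : nat, forall s, exists2 j : nat, (j <= C)%N & forall k : nat, (k < M)%N ->
    x (s + (j + k)%:Z) = None /\ y (s + (j + k)%:Z) = None.
Proof.
move=> ax ay; exists (period M.+3 + period M.+1)%N => s.
have [j jC xj] := none_window M.+2 s ax.
have [i iC yi] := none_window M (s + j%:Z) ay.
exists (j + i)%N; first exact: leq_add.
move=> k kM; have kl : (k < period M)%N := ltn_trans kM (ltn_period M).
split; last by rewrite -addnA PoszD addrA; exact: yi.
rewrite -addnA; apply: xj.
have := radix_ge8 M.+1; have := leq_period (leqnSn M); rewrite (periodS M.+1).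
move: iC kl; clear; nia.
Qed.

Lemma admissible_rigid x y d : admissible x -> admissible y ->
  (forall p : int, (d < `|p|)%N -> x p = y p) -> forall p, x p = y p.
Proof.
move=> ax ay xy p.
have [pd|/xy//] := leqP `|p|%N d.
(* The exceptional interval is [[-d, d]], of length [2 * d + 1 <= period (2 * d)], with a margin [c]
   on each side. *)
pose J := (2 * d)%N; pose c := period J.+2.
pose L := (c + (2 * d).+1 + c)%N.
pose s : int := - (c + d)%:Z.
have [n [f [a [an xa]]]] := ax s L.
have [m [g [b [bm yb]]]] := ay s L.
have [j jL pj] : exists2 j : nat, (j < L)%N & p = s + j%:Z.
  exists (absz (p + (c + d)%:Z)); rewrite /L /s; lia.
rewrite pj xa // yb //.
apply: (@rigid_window _ _ _ _ _ _ c (2 * d).+1 L J) => //; first exact: ltn_period.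
move=> i iL ic; rewrite -xa // -yb //; apply: xy; rewrite /s; lia.
Qed.

(** * Extending and joining blocks *)

(* A block is extended by giving all higher digits the value 1. *)
Section Extension.
Variables (n : nat) (f : nat -> bool).

(** The free bits are repeated periodically, so that slot 1 of each new level contains the preceding
    block. [t k] is the offset of the initial block in the one of level [n + k], and [fits k w] says
    that the latter covers coordinate [w]. *)
Let F (u : nat) : bool := f (u %% period n).

Let t (k : nat) : nat := \sum_(i < k) period (n + i).

Let fits k (w : int) : bool := (0 <= w + (t k)%:Z) && (w + (t k)%:Z < (period (n + k))%:Z).

Let tS k : t k.+1 = (t k + period (n + k))%N.
Proof. exact: big_ord_recr. Qed.

(** The blocks grow by at least one position on both sides, so they eventually cover every
    integer. *)
Let t_bound k : (k <= t k)%N && (t k + k < period (n + k))%N.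
Proof.
elim: k => [|k /andP[IH1 IH2]]; first by rewrite /t big_ord0 addn0 period_gt0.
rewrite tS (addnS n) periodS; have := period_gt0 (n + k); have := radix_ge8 (n + k); nia.
Qed.

Let fits_large k w : (`|w| < k)%N -> fits k w.
Proof. by rewrite /fits; have := t_bound k; lia. Qed.

Let block_step k u : (u < period (n + k))%N ->
  block (n + k).+1 F (period (n + k) + u) = block (n + k) F u.
Proof.
move=> ul; rewrite -[X in (X + u)%N]mul1n block_slot //; last first.
  by have := radix_ge8 (n + k); lia.
apply: block_ext => // v vl; rewrite /F mul1n.
by case/dvdnP: (dvdn_period (leq_addr k n)) => c ->; rewrite modnMDl.
Qed.

Let fitsS k w : fits k w -> fits k.+1 w /\
  block (n + k.+1) F `|w + (t k.+1)%:Z| = block (n + k) F `|w + (t k)%:Z|.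
Proof.
rewrite /fits tS (addnS n) => /andP[h1 h2].
have l8 : (8 * period (n + k) <= period (n + k).+1)%N by rewrite periodS leq_mul2r radix_ge8 orbT.
split; first by move: h1 h2 l8; clear; lia.
rewrite -block_step; last by move: h1 h2; clear; lia.
by congr block; move: h1 h2; clear; lia.
Qed.

Let fits_le k k' w : fits k w -> (k <= k')%N ->
  block (n + k') F `|w + (t k')%:Z| = block (n + k) F `|w + (t k)%:Z|.
Proof.
move=> kw kk'; rewrite -(subnKC kk'); move: (k' - k)%N => {kk'} e.
suff [] : fits (k + e) w /\
  block (n + (k + e)) F `|w + (t (k + e))%:Z| = block (n + k) F `|w + (t k)%:Z| by [].
elim: e => [|e [IH1 IH2]]; first by rewrite addn0.
by rewrite addnS; have [h1 h2] := fitsS IH1; rewrite h2 IH2.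
Qed.

(** Each coordinate is read in a block large enough to cover it. Larger blocks give the same value,
    so every window lies in a single block. *)
Lemma block_extend : exists2 z, admissible z &
  forall r : nat, (r < period n)%N -> z r%:Z = block n f r.
Proof.
pose z (w : int) := block (n + `|w|.+1) F `|w + (t `|w|.+1)%:Z|.
have zE k w : (`|w| < k)%N -> z w = block (n + k) F `|w + (t k)%:Z|.
  by move=> wk; apply/esym/fits_le => //; exact: fits_large.
exists z => [s L|r rl].
  pose k := (`|s| + L).+1; have := t_bound k => tk.
  exists (n + k)%N, F, (absz (s + (t k)%:Z)); split; first by rewrite /k in tk *; lia.
  move=> j jL; rewrite (zE k); last by rewrite /k; lia.
  by congr block; rewrite /k in tk *; lia.
rewrite /z (@fits_le 0) //; last by rewrite /fits /t big_ord0 addn0; lia.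
rewrite /t big_ord0 addn0 addr0; apply: block_ext => // v vl.
by rewrite /F modn_small.
Qed.

End Extension.

(** Slot 1 is used at each new level; this brings two windows to a common level. *)
Lemma block_raise n N f a L : (a + L <= period n)%N -> (n <= N)%N ->
  exists g b, (b + L <= period N)%N /\
    forall j, (j < L)%N -> block N g (b + j) = block n f (a + j).
Proof.
move=> an nN; rewrite -(subnKC nN); elim: (N - n)%N => [|k [g [b [bL gb]]]].
  by exists f, a; rewrite addn0.
rewrite addnS; set m := (n + k)%N in bL gb *.
have q8 := radix_ge8 m.
exists (fun v => g (v - period m)%N), (1 * period m + b)%N; split.
  by rewrite periodS; nia.
move=> j jL; rewrite -addnA block_slot; [|lia|lia|lia].
rewrite -gb //; apply: block_ext; first lia.
by move=> v _; rewrite mul1n addKn.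
Qed.

(** Slots 1 and 2 of one block are filled with the two blocks that contain the given windows. *)
Lemma admissible_join x y s s' L : admissible x -> admissible y ->
  exists z, admissible z /\ exists a b : nat, (a <= b)%N /\
    forall j : nat, (j < L)%N ->
      z (a%:Z + j%:Z) = x (s + j%:Z) /\ z (b%:Z + j%:Z) = y (s' + j%:Z).
Proof.
move=> ax ay.
have [n [f [a [an xa]]]] := ax s L; have [m [g [b [bm yb]]]] := ay s' L.
pose N := maxn n m.
have [{}f' [a' [aN fa]]] := block_raise f an (leq_maxl n m).
have [{}g' [b' [bN gb]]] := block_raise g bm (leq_maxr n m).
rewrite -/N in aN fa bN gb.
have q8 := radix_ge8 N; have lN := period_gt0 N.
pose h v := if (v < 2 * period N)%N then f' (v - period N)%N else g' (v - 2 * period N)%N.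
have [z az zh] := block_extend N.+1 h.
exists z; split=> //; exists (1 * period N + a')%N, (2 * period N + b')%N; split; first lia.
move=> j jL; rewrite -!PoszD !zh ?periodS; [|nia|nia].
rewrite -(addnA (1 * period N)%N) -(addnA (2 * period N)%N) !block_slot; [|lia..].
rewrite xa // yb // -fa // -gb //; split; apply: block_ext; try lia; move=> v vl; rewrite /h.
  by rewrite mul1n addKn ifT //; lia.
by rewrite addKn ifF //; lia.
Qed.

(** * Free positions and the number of blocks *)

(** All digits avoid 0 and the checksum value [radix i - 1], so these positions are active and their
    bits can be prescribed independently. *)
Fixpoint free_pos (n : nat) : seq nat :=
  if n is m.+1 then
    [seq (s * period m + r)%N | s <- iota 1 (radix m).-2, r <- free_pos m]
  else [:: 0%N].

Lemma mem_free_pos n u : u \in free_pos n ->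
  (u < period n)%N /\ forall i, (i < n)%N -> (0 < digit i u < (radix i).-1)%N.
Proof.
elim: n u => [u|n IH u]; first by rewrite inE => /eqP ->.
case/allpairsP=> -[s r] /= [si /IH[rl rd] ->].
have q8 := radix_ge8 n; rewrite mem_iota in si.
split; first by rewrite periodS; nia.
move=> i; rewrite ltnS leq_eqVlt => /orP[/eqP ->|lt_in].
  by have := @digit_digits n 0 s r; rewrite mul0n add0n => -> //; lia.
by rewrite digit_periodic // rd.
Qed.

Lemma size_free_pos n : (period n <= 2 * size (free_pos n))%N.
Proof.
(* This is [prod_(i < n) (1 - 2 / radix i) >= 1 / 2 + 1 / 2 ^ n.+1]. *)
suff : (period n * (2 ^ n + 1) <= 2 * 2 ^ n * size (free_pos n))%N.
  by have := expn_gt0 2 n; nia.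
elim: n => // n IH.
rewrite periodS /= size_allpairs size_iota.
have -> : radix n = (8 * 2 ^ n)%N by rewrite /radix !expnS; lia.
rewrite expnS; have : (0 < 2 ^ n)%N by rewrite expn_gt0.
move: IH; move: (2 ^ n)%N (period n) (size _) => t a S IH t0.
have -> : (8 * t).-2 = (8 * t - 2)%N by lia.
have h1 : (a * (t + 1) * (8 * t - 2) <= 2 * t * S * (8 * t - 2))%N by rewrite leq_mul2r IH orbT.
have h2 : (a * (4 * t * (2 * t + 1)) <= a * ((t + 1) * (8 * t - 2)))%N.
  by rewrite leq_mul2l; apply/orP; right; nia.
by move: h1 h2; rewrite -!mulnA; nia.
Qed.

Lemma uniq_free_pos n : uniq (free_pos n).
Proof.
elim: n => // n IH; apply: allpairs_uniq => //; first exact: iota_uniq.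
move=> [s r] [s' r'] /allpairsP[[? ?] [/= _ /mem_free_pos[rl _] [-> ->]]].
move=> /allpairsP[[? ?] [/= _ /mem_free_pos[rl' _] [-> ->]]] e.
have /= := congr1 (fun u => u %/ period n)%N e; have /= := congr1 (fun u => u %% period n)%N e.
by rewrite !modnMDl !divnMDl ?period_gt0 // !modn_small // !divn_small // !addn0 => -> ->.
Qed.

Lemma admissible_many n :
  exists Z : (size (free_pos n)).-tuple bool -> int -> option bool,
    (forall b, admissible (Z b)) /\
    forall b b', b != b' -> exists2 r : nat, (r < period n)%N & Z b r%:Z <> Z b' r%:Z.
Proof.
(* At positions that are not free, [index] is out of range and the default [false] is taken. *)
pose f (b : (size (free_pos n)).-tuple bool) u := nth false b (index u (free_pos n)).
have [Z HZ] : exists Z : (size (free_pos n)).-tuple bool -> int -> option bool,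
    forall b, admissible (Z b) /\
      forall r : nat, (r < period n)%N -> Z b r%:Z = block n (f b) r.
  have ex b : exists z, admissible z /\
      forall r : nat, (r < period n)%N -> z r%:Z = block n (f b) r.
    by have [z] := block_extend n (f b); exists z.
  by have [Z HZ] := boolp.choice ex; exists Z.
exists Z; split=> [b|b b' bb']; first by have [] := HZ b.
have [i] : exists i, tnth b i != tnth b' i.
  apply/existsP; rewrite -negb_forall; apply: contra bb' => /forallP h.
  by apply/eqP/eq_from_tnth => i; exact/eqP.
rewrite !(tnth_nth false) => ne; have isz := ltn_ord i.
set r := nth 0%N (free_pos n) i.
have rf : r \in free_pos n by exact: mem_nth.
have [rl rd] := mem_free_pos rf.
have fr c : f c r = nth false c i by rewrite /f index_uniq // uniq_free_pos.
exists r => //; rewrite (HZ b).2 // (HZ b').2 // /block.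
have -> : active n r.
  by apply/activeP => k kn; have /andP[] := rd k kn; rewrite lt0n.
rewrite !bits_free => [|k /rd /andP[] //|k /rd /andP[] //].
by rewrite !fr => -[e]; rewrite e eqxx in ne.
Qed.

(** * The subshift as a metric space *)

(* [R] is a phantom parameter, read off by the real-valued metric. *)
Record point (R : realType) :=
  Point { coord :> int -> option bool; coordP : admissible coord }.

HB.instance Definition _ (R : realType) := gen_eqMixin (point R).
HB.instance Definition _ (R : realType) := gen_choiceMixin (point R).

Definition agree (n : nat) (x y : int -> option bool) : Prop :=
  forall k : int, (`|k| < n)%N -> x k = y k.

Lemma agree_sym n x y : agree n x y -> agree n y x.
Proof. by move=> xy k kn; rewrite xy. Qed.

Lemma agree_trans n x y z : agree n x y -> agree n y z -> agree n x z.
Proof. by move=> xy yz k kn; rewrite xy // yz. Qed.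

Lemma agree_le m n x y : (m <= n)%N -> agree n x y -> agree m x y.
Proof. by move=> mn xy k km; rewrite xy // (leq_trans km). Qed.

Section Metric.
Variable R : realType.
Implicit Types x y z : point R.

Definition disagreement x y : pred nat := fun n => `[< ~ agree n x y >].

(* [agree 0] always holds, so the minimum is positive. *)
Definition dist x y : R :=
  if pselect (exists n, disagreement x y n) is left h then (ex_minn h)%:R^-1
  else 0.

Lemma dist_ge0 x y : 0 <= dist x y.
Proof. by rewrite /dist; case: pselect => // h; rewrite invr_ge0. Qed.

Lemma dist_ge n x y : ~ agree n x y -> n%:R^-1 <= dist x y.
Proof.
move=> nxy; have nd : disagreement x y n by apply/asboolP.
rewrite /dist; case: pselect => [h|]; last by case; exists n.
case: ex_minnP => m /asboolP md mn.
have m0 : (0 < m)%N by case: m md {mn} => // -[] k.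
by rewrite lef_pV2 ?posrE ?ltr0n ?ler_nat ?mn // (leq_trans m0) ?mn.
Qed.

Lemma distP x y : (dist x y = 0 /\ x = y) \/
  exists m, [/\ dist x y = m.+1%:R^-1, ~ agree m.+1 x y & agree m x y].
Proof.
rewrite /dist; case: pselect => [h|nh]; [right|left].
  case: ex_minnP => -[/asboolP[]|m /asboolP md mn]; first by move=> k.
  exists m; split=> //; apply: contrapT => nm.
  have /mn : disagreement x y m by exact/asboolP.
  by rewrite ltnn.
split=> //; case: x y nh => [x ax] [y ay] nh.
have e : x = y.
  apply/funext => k; apply: contrapT => xyk; apply: nh; exists `|k|.+1.
  by apply/asboolP => /(_ k (ltnSn _)).
by subst y; rewrite (Prop_irrelevance ax ay).
Qed.

Lemma distxx x : dist x x = 0.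
Proof. by case: (distP x x) => [[]//|[m [_ []]]]. Qed.

Lemma dist_eq0 x y : dist x y = 0 -> x = y.
Proof.
case: (distP x y) => [[]//|[m [-> _ _]]] /eqP.
by rewrite invr_eq0 pnatr_eq0.
Qed.

Lemma dist_sym x y : dist x y = dist y x.
Proof.
wlog suff : x y / dist x y <= dist y x.
  by move=> h; apply/eqP; rewrite eq_le !h.
case: (distP x y) => [[-> _]|[m [-> nm _]]]; first exact: dist_ge0.
by apply: dist_ge => /agree_sym.
Qed.

(** Where [x] and [z] first disagree, [y] disagrees with one of them, so one summand alone
    suffices. *)
Lemma dist_triangle y x z : dist x z <= dist x y + dist y z.
Proof.
case: (distP x z) => [[-> _]|[m [-> nm _]]]; first by rewrite addr_ge0 ?dist_ge0.
have [xy|xy] := pselect (agree m.+1 x y).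
  rewrite (le_trans (@dist_ge m.+1 y z _)) ?lerDr ?dist_ge0 // => yz.
  exact/nm/(agree_trans xy).
by rewrite (le_trans (dist_ge xy)) // lerDl dist_ge0.
Qed.

Lemma dist_lt n x y : dist x y < n.+1%:R^-1 <-> agree n.+1 x y.
Proof.
split=> [d|xy]; first by apply: contrapT => /dist_ge; rewrite leNgt d.
case: (distP x y) => [[-> _]|[m [-> nm _]]]; first by rewrite invr_gt0 ltr0n.
rewrite ltf_pV2 ?posrE ?ltr0n // ltr_nat ltnNge; apply/negP => mn.
exact/nm/(agree_le mn).
Qed.

End Metric.

HB.instance Definition _ (R : realType) :=
  isMetric.Build R (point R) (@distxx R) (@dist_eq0 R) (@dist_sym R) (@dist_triangle R).

(** * Compactness, the shift and transitivity *)

Section Topology.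
Variable R : realType.
Implicit Types x y z : point R.

Lemma mdist_lt n x y : mdist x y < n.+1%:R^-1 <-> agree n.+1 x y.
Proof. exact: dist_lt. Qed.

Lemma nbhs_agreeP x (A : set (point R)) :
  nbhs x A <-> exists n, forall y, agree n x y -> A y.
Proof.
split.
  case/nbhs_ballP => e /= e0; rewrite ballEmdist => eA.
  have [m] := ltr_add_invr e0; rewrite add0r => me.
  by exists m.+1 => y /mdist_lt xy; apply: eA => /=; exact: lt_trans me.
case=> n nA; apply/nbhs_ballP; exists n.+1%:R^-1 => /=; first by rewrite invr_gt0 ltr0n.
by rewrite ballEmdist => y /= /mdist_lt xy; apply: nA; exact: agree_le xy.
Qed.

(** An ultrafilter selects one of the three symbols at each coordinate, hence a limit sequence. Each
    window of the limit is also a window of some point, so the limit is admissible. *)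
Lemma point_compact : compact [set: point R].
Proof.
rewrite compact_ultra => F UF _.
have ex k : exists v, F [set x : point R | coord x k = v].
  pose B v := [set x : point R | coord x k = v].
  have [|h0] := in_ultra_setVsetC (B None) UF; first by exists None.
  have [|h1] := in_ultra_setVsetC (B (Some true)) UF; first by exists (Some true).
  have [|h2] := in_ultra_setVsetC (B (Some false)) UF; first by exists (Some false).
  have : F set0; last by move/filter_ex => [].
  apply: filterS (filterI h0 (filterI h1 h2)) => x [/= + [+ +]].
  by rewrite /B /=; case: (coord x k) => [[]|].
have [v Fv] := choice ex.
have Fw s L : F [set x : point R |
    forall j : nat, (j < L)%N -> coord x (s + j%:Z) = v (s + j%:Z)].
  elim: L => [|L IH]; first by apply: filterS filterT.
  apply: filterS (filterI IH (Fv (s + L%:Z))) => x [/= h1 h2] j.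
  by rewrite ltnS leq_eqVlt => /orP[/eqP ->//|/h1].
have av : admissible v.
  move=> s L; have [x xv] := filter_ex (Fw s L).
  have [n [f [a [an xa]]]] := coordP x s L.
  by exists n, f, a; split=> // j jL; rewrite -xv // xa.
exists (Point R av); split=> // A /nbhs_agreeP[n nA].
apply: filterS (Fw (- n%:Z) (2 * n)%N) => x xv; apply: nA => k kn.
have -> : k = - n%:Z + (absz (k + n%:Z))%:Z by lia.
by rewrite xv //; lia.
Qed.

Definition shift (t : int) x : point R := Point R (admissible_shift t (coordP x)).

Lemma point_eq x y : coord x =1 coord y -> x = y.
Proof.
case: (distP x y) => [[]//|[m [_ nm _]]] xy.
by case: nm => k _; exact: xy.
Qed.

Lemma shiftK t : cancel (shift t) (shift (- t)).
Proof. by move=> x; apply: point_eq => k; rewrite /= subrK. Qed.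

Lemma iter_shift t n x k : coord (iter n (shift t) x) k = coord x (k + t *+ n).
Proof.
elim: n k => [|n IH] k; first by rewrite mulr0n addr0.
by rewrite iterS /= IH mulrS addrA.
Qed.

Lemma shift_continuous t : continuous (shift t).
Proof.
move=> x A /nbhs_agreeP[n nA]; apply/nbhs_agreeP; exists (n + `|t|)%N => y xy.
by apply: nA => k kn; apply: xy; lia.
Qed.

Lemma shift_homeomorphism t : homeomorphism (shift t) (shift (- t)).
Proof.
split; [exact: shiftK| |exact: shift_continuous|exact: shift_continuous].
by rewrite -{2}[t]opprK; exact: shiftK.
Qed.

Lemma shift_transitive : topologically_transitive (shift 1).
Proof.
move=> U V oU oV [x Ux] [y Vy].
have /nbhs_agreeP[n xU] : nbhs x U by exact: open_nbhs_nbhs.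
have /nbhs_agreeP[m yV] : nbhs y V by exact: open_nbhs_nbhs.
pose M := maxn n m.
have [z [az [a [b [ab zj]]]]] :=
  admissible_join (- M%:Z) (- M%:Z) (2 * M)%N (coordP x) (coordP y).
(* The first window, moved from [a] to [-M], puts the point in [U]; after [b - a] more shifts the
   second window takes its place. *)
exists (b - a)%N, (shift (a + M)%:Z (Point R az)); split.
  apply: xU => k kn; have kM : (`|k| < M)%N := leq_trans kn (leq_maxl _ _).
  have [j jM kj] : exists2 j : nat, (j < 2 * M)%N & - M%:Z + j%:Z = k.
    by exists (absz (k + M%:Z)%R); lia.
  have [+ _] := zj _ jM; rewrite kj => <- /=; congr z; lia.
rewrite /preimage /=; apply: yV => k kn.
have kM : (`|k| < M)%N := leq_trans kn (leq_maxr _ _).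
have [j jM kj] : exists2 j : nat, (j < 2 * M)%N & - M%:Z + j%:Z = k.
  by exists (absz (k + M%:Z)%R); lia.
rewrite iter_shift /=; have [_ +] := zj _ jM; rewrite kj => <-; congr z; lia.
Qed.

End Topology.

(** * Scrambled pairs and entropy *)

Section LimSup.
Variable R : realType.
Implicit Types (u v : nat -> \bar R) (c : \bar R).
Local Open Scope ereal_scope.

Lemma limn_esup_ge u c :
  (forall N, exists2 n, (N <= n)%N & c <= u n) -> c <= limn_esup u.
Proof.
move=> h; apply: le_ereal_inf_tmp => _ [A [N _ NA] <-].
have [n Nn cn] := h N; apply: (le_trans cn); apply: ereal_sup_ubound.
by exists n => //; exact: NA.
Qed.

Lemma limn_esup_le u v : (forall n, u n <= v n) -> limn_esup u <= limn_esup v.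
Proof.
move=> uv; apply: le_ereal_inf_tmp => _ [A oA <-].
apply: (@le_trans _ _ (ereal_sup (u @` A))).
  by apply: ereal_inf_lbound; exists A.
apply: ge_ereal_sup => _ [n An <-]; apply: (le_trans (uv n)).
by apply: ereal_sup_ubound; exists n.
Qed.

Lemma limn_einf_eq0 u : (forall n, 0 <= u n) ->
  (forall (e : R) N, (0 < e)%R -> exists2 n, (N <= n)%N & u n <= e%:E) ->
  limn_einf u = 0.
Proof.
move=> u0 h; rewrite /limn_einf.
suff -> : limn_esup (\- u) = 0 by rewrite oppe0.
apply/eqP; rewrite eq_le; apply/andP; split.
  apply: (@le_trans _ _ (ereal_sup ((\- u) @` setT))).
    by apply: ereal_inf_lbound; exists setT => //; exact: filterT.
  by apply: ge_ereal_sup => _ [n _ <-]; rewrite oppe_le0.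
apply/lee_addgt0Pr => e e0; rewrite -leeBlDr // add0e.
apply: limn_esup_ge => N; have [n Nn un] := h e N e0.
by exists n => //; rewrite leeN2.
Qed.

End LimSup.

(** * Scrambled pairs *)

Section Scrambled.
Variable R : realType.
Implicit Types x y : point R.

(** Agreement on arbitrarily large central windows gives liminf 0; a disagreement at coordinate 0
    makes the distance at least 1, so the limsup is positive. *)
Lemma positively_scrambledI (T : point R -> point R) x y :
  (forall M N, exists2 n, (N <= n)%N & agree M (iter n T x) (iter n T y)) ->
  (forall N, exists2 n, (N <= n)%N & coord (iter n T x) 0 <> coord (iter n T y) 0) ->
  positively_scrambled T x y.
Proof.
move=> prox far; split.
  apply: limn_einf_eq0 => [n|e N e0]; first by rewrite lee_fin mdist_ge0.
  have [M] := ltr_add_invr e0; rewrite add0r => Me.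
  have [n Nn xy] := prox M.+1 N; exists n => //.
  by rewrite lee_fin ltW // (lt_trans _ Me) //; exact/mdist_lt.
apply: (@lt_le_trans _ _ (1%:E)); first by rewrite lte_fin.
apply: limn_esup_ge => N; have [n Nn xy] := far N; exists n => //.
rewrite lee_fin leNgt -[ltRHS]invr1; apply/negP => /(mdist_lt 0) h.
exact/xy/h.
Qed.

Lemma shift_completely_scrambled :
  completely_scrambled (@shift R 1) (@shift R (-1)).
Proof.
move=> x y xy.
have [pos|npos] := pselect (forall N : nat, exists2 p : nat, (N <= p)%N &
  coord x p%:Z <> coord y p%:Z).
  left; apply: positively_scrambledI => [M N|N].
    have [C HC] := both_none (2 * M)%N (coordP x) (coordP y).
    (* The common run of [None]s starts at [N + j] and has length [2 * M]; the extra [M] iterations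
       centre it. *)
    have [j jC jn] := HC N%:Z; exists (N + j + M)%N; first by lia.
    move=> k kM; rewrite !iter_shift.
    have -> : k + 1 *+ (N + j + M) = N%:Z + (j + absz (k + M%:Z)%R)%N%:Z by lia.
    by have [|-> ->] := jn (absz (k + M%:Z)%R); first lia.
  have [n Nn d] := pos N; exists n => //.
  by rewrite !iter_shift; have -> : 0 + 1 *+ n = n%:Z by lia.
have [neg|nneg] := pselect (forall N : nat, exists2 p : nat, (N <= p)%N &
  coord x (- p%:Z) <> coord y (- p%:Z)).
  right; apply: positively_scrambledI => [M N|N].
    have [C HC] := both_none (2 * M)%N (coordP x) (coordP y).
    (* The run starts at most [C] further right, so its centre [-(N + C + M - j)] lies at or to the
       left of [-N]. *)
    have [j jC jn] := HC (- (N + C + 2 * M)%N%:Z).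
    exists (N + C + M - j)%N; first by lia.
    move=> k kM; rewrite !iter_shift.
    have -> : k + (-1) *+ (N + C + M - j) =
      - (N + C + 2 * M)%N%:Z + (j + absz (k + M%:Z)%R)%N%:Z by lia.
    by have [|-> ->] := jn (absz (k + M%:Z)%R); first lia.
  have [n Nn d] := neg N; exists n => //.
  by rewrite !iter_shift; have -> : 0 + (-1) *+ n = - n%:Z by lia.
(* Differences are now bounded in both directions, and rigidity makes the points equal. *)
case: xy; apply: point_eq.
move/existsNP: npos => [N hN]; move/existsNP: nneg => [N' hN'].
apply: (admissible_rigid (d := maxn N N') (coordP x) (coordP y)) => p pd.
apply: contrapT => np.
have [p0|p0] := leP 0 p.
  apply: hN; exists `|p|%N; first by lia.
  by rewrite gez0_abs.
apply: hN'; exists `|p|%N; first by lia.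
by rewrite ltz0_abs // opprK.
Qed.

End Scrambled.

(** * Positive entropy *)

Section Entropy.
Variable R : realType.

Lemma sep_card_ge0 (X : metricType R) (T : X -> X) n (e : R) :
  (0 <= sep_card T n e)%E.
Proof.
apply: ereal_sup_ubound; exists fset0; last by rewrite cardfs0.
by move=> x y; rewrite inE.
Qed.

Lemma sep_card_le (X : metricType R) (T : X -> X) n (e e' : R) :
  e <= e' -> (sep_card T n e' <= sep_card T n e)%E.
Proof.
move=> ee; apply: ereal_sup_le => _ [E EE <-]; exists E => // x y xE yE xy.
by have [k kn d] := EE x y xE yE xy; exists k => //; exact: le_lt_trans d.
Qed.

Definition growth (X : metricType R) (T : X -> X) (e : R) : \bar R :=
  limn_esup (fun n : nat => (n%:R^-1)%:E * lne (sep_card T n e))%E.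

Lemma lne_homo (a b : \bar R) : (0 <= a -> a <= b -> lne a <= lne b)%E.
Proof.
by move=> a0 ab; rewrite lee_lne // in_itv /= ?a0 ?(le_trans a0 ab) leey.
Qed.

(** The growth rate is nonincreasing in the scale, so its limit at 0 exists and inherits lower
    bounds valid at small scales. *)
Lemma topological_entropy_ge (X : metricType R) (T : X -> X) (c : \bar R) (e0 : R) :
  0 < e0 -> (forall e, 0 < e -> e < e0 -> (c <= growth T e)%E) ->
  (c <= topological_entropy T)%E.
Proof.
move=> e00 h; apply: lime_ge.
  apply: nonincreasing_at_right_is_cvge; apply: nearW => b x y _ _ xy.
  apply: limn_esup_le => n; apply: lee_wpmul2l; first by rewrite lee_fin invr_ge0.
  by apply: lne_homo; [exact: sep_card_ge0|exact: sep_card_le].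
near=> e; apply: h; near: e; first exact: nbhs_right_gt.
exact: nbhs_right_lt.
Unshelve. all: by end_near. Qed.

(** Two of the points differ at some [r < period m]; [r] shifts bring this to coordinate 0, where
    the distance is at least 1. *)
Lemma sep_card_shift m (e : R) : e < 1 ->
  (((2 ^ size (free_pos m))%N%:R)%:E <= sep_card (@shift R 1) (period m) e)%E.
Proof.
move=> e1; have [Z [aZ dZ]] := admissible_many m.
pose P b : point R := Point R (aZ b).
have Pinj : injective P.
  move=> b b' PE; apply/eqP; apply: contrapT => /negP /dZ [r _].
  by move/(congr1 (fun x => coord x r%:Z)): PE.
apply: ereal_sup_ubound.
exists [fset x in map P (enum {: (size (free_pos m)).-tuple bool})]%fset; last first.
  rewrite card_fseq undup_id; last by rewrite map_inj_uniq // enum_uniq.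
  by rewrite size_map -cardE card_tuple card_bool.
move=> x y; rewrite !inE => /mapP[b _ ->] /mapP[b' _ ->] bb'.
have /dZ[r rl d] : b != b' by apply/eqP => ebb; apply: bb'; rewrite ebb.
exists r => //; apply: (lt_le_trans e1).
rewrite leNgt -[ltRHS]invr1; apply/negP => /(mdist_lt 0) /(_ 0 isT).
by rewrite !iter_shift; have -> : 0 + 1 *+ r = r%:Z by lia.
Qed.

Lemma shift_entropy_gt0 : (0 < topological_entropy (@shift R 1))%E.
Proof.
have ln2 : 0 < ln 2 :> R by rewrite ln_gt0 // ltr1n.
(* At least half of the positions of a block are free, and each contributes [ln 2]; for the limsup
   the times [period N] suffice. *)
apply: (@lt_le_trans _ _ (ln 2 / 2)%:E); first by rewrite lte_fin divr_gt0.
apply: (@topological_entropy_ge _ _ _ 1) => // e e0 e1.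
apply: limn_esup_ge => N; exists (period N); first exact/ltnW/ltn_period.
apply: (@le_trans _ _ ((period N)%:R^-1%:E * lne ((2 ^ size (free_pos N))%N%:R)%:E)%E).
  have D0 : (0 : R) < (2 ^ size (free_pos N))%N%:R by rewrite ltr0n expn_gt0.
  have lN : (0 : R) < (period N)%:R by rewrite ltr0n period_gt0.
  have lD : (period N)%:R <= 2 * (size (free_pos N))%:R :> R.
    by rewrite -natrM ler_nat size_free_pos.
  rewrite lne_EFin // -EFinM lee_fin natrX lnXn // -[_ *+ size _]mulr_natl [leRHS]mulrC.
  rewrite ler_pdivlMr // mulrAC ler_pdivrMr // [leRHS]mulrC [_%:R * ln _]mulrC.
  by rewrite [leRHS]mulrCA ler_wpM2l ?(ltW ln2).
apply: lee_wpmul2l; first by rewrite lee_fin invr_ge0.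
by apply: lne_homo; [rewrite lee_fin|exact: sep_card_shift].
Qed.

End Entropy.

Theorem corollary1p2 (R : realType) :
  exists (X : metricType R) (T Tinv : X -> X),
    compact [set: X]%classic /\
    homeomorphism T Tinv /\
    topologically_transitive T /\
    completely_scrambled T Tinv /\
    (0 < topological_entropy T)%E.
Proof.
exists (point R), (@shift R 1), (@shift R (-1)).
split; first exact: point_compact.
split; first exact: shift_homeomorphism.
split; first exact: shift_transitive.
by split; [exact: shift_completely_scrambled|exact: shift_entropy_gt0].
Qed.
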